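(* Let $\Lambda,\Gamma$ be probability distributions on $\mathbb{Z}_d$. If $\mathsf{A}_\Lambda$ and $\mathsf{B}_\Gamma$ are jointly measurable, then they have a joint observable which is a covariant phase space observable.
   Context: Let $\mathcal{H}$ be a complex Hilbert space with $\dim\mathcal{H}=d\ge 2$ (inner product linear in the second argument). $\mathbb{Z}_d=\{0,\dots,d-1\}$ with arithmetic modulo $d$, and $\omega=e^{2\pi i/d}$. An observable with finite outcome set $\Omega$ is a map $x\mapsto\mathsf{E}(x)$ from $\Omega$ to positive operators on $\mathcal{H}$ with $\sum_{x\in\Omega}\mathsf{E}(x)=\mathbb{1}$. Fix an orthonormal basis $\{\varphi_j\}_{j\in\mathbb{Z}_d}$ of $\mathcal{H}$ and set $\psi_k=\frac{1}{\sqrt d}\sum_{h\in\mathbb{Z}_d}\omega^{hk}\varphi_h$ for $k\in\mathbb{Z}_d$; $\{\psi_k\}$ is an orthonormal basis. Put $\mathsf{A}(j)=|\varphi_j\rangle\langle\varphi_j|$, $\mathsf{B}(k)=|\psi_k\rangle\langle\psi_k|$. For probability distributions $\Lambda,\Gamma$ on $\mathbb{Z}_d$ define observables on $\mathbb{Z}_d$ by $\mathsf{A}_\Lambda(j)=\sum_{i\in\mathbb{Z}_d}\Lambda(j-i)\mathsf{A}(i)$ and $\mathsf{B}_\Gamma(k)=\sum_{i\in\mathbb{Z}_d}\Gamma(k-i)\mathsf{B}(i)$. A joint observable of two observables $\mathsf{E},\mathsf{F}$ on $\mathbb{Z}_d$ is an observable $\mathsf{C}$ on $\mathbb{Z}_d\times\mathbb{Z}_d$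 with $\sum_{k}\mathsf{C}(j,k)=\mathsf{E}(j)$ for all $j$ and $\sum_{j}\mathsf{C}(j,k)=\mathsf{F}(k)$ for all $k$; $\mathsf{E}$ and $\mathsf{F}$ are jointly measurable if a joint observable exists. Let $U_x\varphi_k=\varphi_{k+x}$ and $V_y\varphi_k=\omega^{yk}\varphi_k$ for $x,y,k\in\mathbb{Z}_d$. An observable $\mathsf{C}$ on $\mathbb{Z}_d\times\mathbb{Z}_d$ is a covariant phase space observable if $U_xV_y\mathsf{C}(j,k)V_y^*U_x^*=\mathsf{C}(j+x,k+y)$ for all $j,k,x,y\in\mathbb{Z}_d$. *)

(* Defs.v *)
From HB Require Import structures.
From mathcomp Require Import all_boot all_order all_algebra sesquilinear.
From mathcomp Require Import complex.
From mathcomp Require Import boolp classical_sets reals trigo.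

Set Implicit Arguments.
Unset Strict Implicit.
Unset Printing Implicit Defensive.

Import Order.TTheory GRing.Theory Num.Theory.
Local Open Scope complex_scope.
Local Open Scope ring_scope.

(* The inner product of a finite-dimensional complex Hilbert space H is a
   [{dot H for Num.conj}], which MathComp takes to be linear in its FIRST
   argument.  [inner] swaps the arguments, so that [inner dot u v] is <u|v>,
   linear in v and antilinear in u. *)
Definition inner (R : realType) (H : vectType R[i])
  (dot : {dot H for Num.conj}) (u v : H) : R[i] := dot v u.

Section Operators.
Variables (R : realType) (H : vectType R[i]) (dot : {dot H for Num.conj}).
Implicit Types (u v : H) (T S : 'End(H)).

Lemma innerC u v : inner dot v u = (inner dot u v)^*.
Proof. by rewrite /inner hermC /= expr0 mul1r. Qed.

Lemma innerZr a u v : inner dot u (a *: v) = a * inner dot u v.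
Proof. exact: linearZl_LR. Qed.

Lemma innerZl a u v : inner dot (a *: u) v = a^* * inner dot u v.
Proof. exact: linearZr_LR. Qed.

Lemma inner_sumr (I : finType) u (v : I -> H) :
  inner dot u (\sum_i v i) = \sum_i inner dot u (v i).
Proof. exact: linear_sumlz. Qed.

Lemma inner_suml (I : finType) (u : I -> H) v :
  inner dot (\sum_i u i) v = \sum_i inner dot (u i) v.
Proof. exact: linear_sumr. Qed.

Definition ketbra u v : 'End(H) := linfun (fun w : H => inner dot v w *: u).

Lemma ketbraE u v w : ketbra u v w = inner dot v w *: u.
Proof.
rewrite /ketbra.
have lin : linear (fun w : H => inner dot v w *: u).
  by move=> a x y; rewrite /inner linearPl /= scalerDl scalerA.
pose f := HB.pack_for {linear H -> H} (fun w : H => inner dot v w *: u)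
  (GRing.isLinear.Build _ _ _ _ _ lin).
exact: (lfunE f).
Qed.

(* The order of R[i] makes [0 <= z] mean that z is real and nonnegative. *)
Definition positive_op T := forall v, 0 <= inner dot v (T v).

Definition is_adjoint T S := forall u v, inner dot u (T v) = inner dot (S u) v.

(* The junk value 0 of [xget] is never used: see [adjointP] below. *)
Definition adjoint T : 'End(H) := xget 0 [set S : 'End(H) | is_adjoint T S]%classic.

Definition observable (Omega : finType) (E : Omega -> 'End(H)) :=
  (forall x, positive_op (E x)) /\ \sum_x E x = \1%VF.

Definition joint_observable (Omega1 Omega2 : finType) (E : Omega1 -> 'End(H))
    (F : Omega2 -> 'End(H)) (C : Omega1 * Omega2 -> 'End(H)) :=
  [/\ observable C,
      forall j, \sum_k C (j, k) = E j
    & forall k, \sum_j C (j, k) = F k].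

Definition jointly_measurable (Omega1 Omega2 : finType)
    (E : Omega1 -> 'End(H)) (F : Omega2 -> 'End(H)) :=
  exists C, joint_observable E F C.

Definition orthonormal_basis (I : finType) (phi : I -> H) :=
  orthonormal dot (codom phi) && basis_of fullv (codom phi).

Lemma orthonormal_basisP (I : finType) (phi : I -> H) :
  orthonormal_basis phi ->
  forall i j, inner dot (phi i) (phi j) = (i == j)%:R.
Proof.
case/andP=> /orthonormalP[uphi ophi] _ i j.
rewrite /inner ophi ?codom_f // eq_sym inj_eq //.
exact/injectiveP.
Qed.

Lemma orthonormal_basis_expand (I : finType) (phi : I -> H) :
  orthonormal_basis phi -> forall v, v = \sum_i inner dot (phi i) v *: phi i.
Proof.
move=> onb v; have := orthonormal_basisP onb => ophi.
have : v \in <<codom phi>>%VS.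
  by case/andP: onb => _ /span_basis->; rewrite memvf.
move/(@coord_span _ _ _ (in_tuple (codom phi)))/esym.
set s := \sum_(i < _) _ => sv.
have [a ->] : exists a : I -> R[i], v = \sum_i a i *: phi i.
  have/injectiveP inj : injectiveb phi.
    by case/andP: onb => /orthonormalP[].
  have gen (K : finType) (c : K -> R[i]) (g : K -> I) :
      exists a : I -> R[i], \sum_k c k *: phi (g k) = \sum_i a i *: phi i.
    exists (fun i => \sum_(k | g k == i) c k).
    rewrite (partition_big g xpredT) //=; apply: eq_bigr => i _.
    by rewrite scaler_suml; apply: eq_bigr => k /eqP->.
  have idx (k : 'I_(size (codom phi))) :
      exists i, (in_tuple (codom phi))`_k == phi i.
    by have /codomP[i ->] := mem_nth 0 (ltn_ord k); exists i.
  have [a ea] := gen _ (fun k => coord (in_tuple (codom phi)) k v)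
                       (fun k => xchoose (idx k)).
  exists a; rewrite -ea -[LHS]sv; apply: eq_bigr => k _.
  by congr (_ *: _); apply/eqP/(xchooseP (idx k)).
apply: eq_bigr => i _; congr (_ *: _).
rewrite inner_sumr (bigD1 i) //= big1 => [|j ji].
  by rewrite innerZr ophi eqxx mulr1 addr0.
by rewrite innerZr ophi eq_sym (negbTE ji) mulr0.
Qed.

Lemma adjointP (I : finType) (phi : I -> H) T :
  orthonormal_basis phi -> is_adjoint T (adjoint T).
Proof.
move=> onb; rewrite /adjoint.
case: xgetP => [S _ //|/(_ (\sum_i ketbra (phi i) (T (phi i))))/=[]].
move=> u v; rewrite sum_lfunE.
under eq_bigr do rewrite ketbraE.
rewrite [in LHS](orthonormal_basis_expand onb v) linear_sum.
rewrite inner_sumr inner_suml; apply: eq_bigr => i _ /=.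
by rewrite linearZ innerZr innerZl -innerC mulrC.
Qed.

End Operators.

Section PhaseSpace.
Variables (R : realType) (d : nat).

(* For d >= 2 the type 'Z_d has the elements 0, ..., d-1 and addition mod d. *)
Definition prob_distr (Lambda : 'Z_d -> R) :=
  (forall i, 0 <= Lambda i) /\ \sum_i Lambda i = 1.

Definition omega : R[i] := cos (2 * pi / d%:R) +i* sin (2 * pi / d%:R).

Variables (H : vectType R[i]) (dot : {dot H for Num.conj}) (phi : 'Z_d -> H).

Definition psi (k : 'Z_d) : H :=
  ((Num.sqrt d%:R)^-1)%:C *: \sum_(h : 'Z_d) omega ^+ (h * k)%N *: phi h.

Definition obsA (j : 'Z_d) : 'End(H) := ketbra dot (phi j) (phi j).
Definition obsB (k : 'Z_d) : 'End(H) := ketbra dot (psi k) (psi k).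

Definition smeared (Lambda : 'Z_d -> R) (E : 'Z_d -> 'End(H)) (j : 'Z_d) :
  'End(H) := \sum_(i : 'Z_d) (Lambda (j - i))%:C *: E i.

Definition shiftU (x : 'Z_d) : 'End(H) :=
  \sum_(k : 'Z_d) ketbra dot (phi (k + x)) (phi k).
Definition phaseV (y : 'Z_d) : 'End(H) :=
  \sum_(k : 'Z_d) omega ^+ (y * k)%N *: ketbra dot (phi k) (phi k).

Lemma shiftUE x k : orthonormal_basis dot phi -> shiftU x (phi k) = phi (k + x).
Proof.
move=> /orthonormal_basisP ophi; rewrite sum_lfunE (bigD1 k) //= big1.
  by rewrite ketbraE ophi eqxx scale1r addr0.
by move=> j /negbTE jk; rewrite ketbraE ophi jk scale0r.
Qed.

Lemma phaseVE y k : orthonormal_basis dot phi ->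
  phaseV y (phi k) = omega ^+ (y * k)%N *: phi k.
Proof.
move=> /orthonormal_basisP ophi; rewrite sum_lfunE (bigD1 k) //= big1.
  by rewrite scale_lfunE ketbraE ophi eqxx scale1r addr0.
by move=> j /negbTE jk; rewrite scale_lfunE ketbraE ophi jk scale0r scaler0.
Qed.

Definition covariant_phase_space (C : 'Z_d * 'Z_d -> 'End(H)) :=
  observable dot C /\
  forall j k x y : 'Z_d,
    (shiftU x \o phaseV y \o C (j, k)
       \o adjoint dot (phaseV y) \o adjoint dot (shiftU x))%VF
    = C (j + x, k + y).

End PhaseSpace.

(* Main.v *)
(* Average the given joint observable C over the Weyl group: replace C(j, k)
   by the mean over (x, y) of W C(j - x, k - y) W^* with W = U_x V_y.
   Conjugation by W maps A(j) to A(j + x) and B(k) to B(k + y), so the marginals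
   are unchanged, while composing two conjugations adds the indices (the phases
   of the projective representation cancel), so the mean is covariant.  All the
   identities are read off from the matrix elements
   <phi_a | W T W^* phi_b> = omega^(y (a - b)) <phi_(a-x) | T phi_(b-x)>. *)
Require Import Defs.
From mathcomp Require Import all_boot all_order all_algebra sesquilinear.
From mathcomp Require Import complex.
From mathcomp Require Import reals trigo.
From mathcomp Require Import ring.

Set Implicit Arguments.
Unset Strict Implicit.
Unset Printing Implicit Defensive.

Import Order.TTheory GRing.Theory Num.Theory.
Local Open Scope ring_scope.

(** * Powers of [omega] as characters of ['Z_d] *)

Section Character.
Variables (R : realType) (d : nat).
Hypothesis hd : (2 <= d)%N.

Lemma omegaX n : omega R d ^+ n =
  Complex (cos (n%:R * (2 * pi / d%:R))) (sin (n%:R * (2 * pi / d%:R))).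
Proof.
elim: n => [|n IH]; first by rewrite expr0 !mul0r cos0 sin0.
rewrite exprS IH /omega -(natr1 n) [in RHS]mulrDl [1 * _]mul1r cosD sinD.
by apply/eqP; rewrite eq_complex /=; apply/andP; split; apply/eqP; ring.
Qed.

Lemma omegaXd : omega R d ^+ d = 1.
Proof.
have d0 : d%:R != 0 :> R by rewrite pnatr_eq0 -lt0n (ltn_trans _ hd).
rewrite omegaX mulrCA mulfV // mulr1 mulr_natl.
by rewrite cos2pi sin2pi.
Qed.

Lemma conj_omega : omega R d * (omega R d)^* = 1.
Proof.
rewrite /omega; apply/eqP; rewrite eq_complex /=.
by rewrite mulrN opprK -!expr2 cos2Dsin2 mulrN [_ * cos _]mulrC addNr !eqxx.
Qed.

Definition chi (x : 'Z_d) : R[i] := omega R d ^+ x.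

(** Arithmetic in ['Z_d] reduces modulo [(Zp_trunc d).+2], which is [d] once [2 <= d], and powers of
    [omega] have period [d]. *)
Lemma omegaX_mod n : omega R d ^+ (n %% (Zp_trunc d).+2) = omega R d ^+ n.
Proof. by rewrite Zp_cast // expr_mod // omegaXd. Qed.

Lemma chiD x y : chi (x + y) = chi x * chi y.
Proof. by rewrite /chi /= omegaX_mod exprD. Qed.

Lemma chiM (x y : 'Z_d) : omega R d ^+ (x * y)%N = chi (x * y).
Proof. by rewrite /chi /= omegaX_mod. Qed.

Lemma chi0 : chi 0 = 1.
Proof. by rewrite /chi expr0. Qed.

Lemma conj_chi x : (chi x)^* = chi (- x).
Proof.
have chiC : chi x * (chi x)^* = 1.
  by rewrite /chi rmorphXn -exprMn conj_omega expr1n.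
by rewrite -[LHS]mul1r -chi0 -(addNr x) chiD -mulrA chiC mulr1 //.
Qed.

End Character.

(** * Conjugation by Weyl operators and its matrix elements *)

Section Weyl.
Variables (R : realType) (d : nat) (H : vectType R[i]).
Variables (dot : {dot H for Num.conj}) (phi : 'Z_d -> H).
Hypothesis hd : (2 <= d)%N.
Hypothesis hphi : orthonormal_basis dot phi.
Implicit Types (x y j k : 'Z_d) (T S : 'End(H)).

Local Notation chi := (@chi R d).

Definition mel T a b := inner dot (phi a) (T (phi b)).

Lemma mel_inj T S : (forall a b, mel T a b = mel S a b) -> T = S.
Proof.
move=> TS; apply/lfunP => v.
rewrite (orthonormal_basis_expand hphi v) !linear_sum.
apply: eq_bigr => b _; rewrite !linearZ /=; congr (_ *: _).
rewrite (orthonormal_basis_expand hphi (T _)).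
rewrite [RHS](orthonormal_basis_expand hphi).
by apply: eq_bigr => a _; congr (_ *: _); apply: TS.
Qed.

Lemma inner_phi_inj u v :
  (forall a, inner dot (phi a) u = inner dot (phi a) v) -> u = v.
Proof.
move=> uv; rewrite (orthonormal_basis_expand hphi u).
rewrite [RHS](orthonormal_basis_expand hphi).
by apply: eq_bigr => a _; rewrite uv.
Qed.

Lemma mel_sum (I : finType) (P : pred I) (F : I -> 'End(H)) a b :
  mel (\sum_(i | P i) F i) a b = \sum_(i | P i) mel (F i) a b.
Proof.
by rewrite big_mkcond [RHS]big_mkcond /mel sum_lfunE inner_sumr;
  apply: eq_bigr => i _; case: ifP => // _; rewrite zero_lfunE /inner linear0l.
Qed.

Lemma melZ (c : R[i]) T a b : mel (c *: T) a b = c * mel T a b.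
Proof. by rewrite /mel scale_lfunE innerZr. Qed.

Lemma mel_ketbra u v a b :
  mel (ketbra dot u v) a b = inner dot (phi a) u * inner dot v (phi b).
Proof. by rewrite /mel ketbraE innerZr mulrC. Qed.

(** Has the exact shape of the left side in [covariant_phase_space], so covariance becomes an
    equation about [conjW]. *)
Definition conjW x y T : 'End(H) :=
  (shiftU dot phi x \o phaseV dot phi y \o T
     \o adjoint dot (phaseV dot phi y) \o adjoint dot (shiftU dot phi x))%VF.

(** [adjoint] is known only through [is_adjoint], so its values are found by pairing with each
    [phi b] and moving the operator across. *)
Lemma adj_shiftU x a : adjoint dot (shiftU dot phi x) (phi a) = phi (a - x).
Proof.
apply: inner_phi_inj => b; rewrite innerC -(adjointP _ hphi) shiftUE //.
by rewrite -innerC !(orthonormal_basisP hphi) eq_sym -subr_eq eq_sym.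
Qed.

Lemma adj_phaseV y a :
  adjoint dot (phaseV dot phi y) (phi a) = chi (- (y * a)) *: phi a.
Proof.
apply: inner_phi_inj => b; rewrite innerC -(adjointP _ hphi) phaseVE //.
rewrite !innerZr chiM // rmorphM /= -innerC conj_chi //.
rewrite !(orthonormal_basisP hphi).
(* The two phases need to agree only at [b = a]; elsewhere both sides vanish by orthogonality. *)
by have [->//|_] := eqVneq b a; rewrite !mulr0.
Qed.

Lemma mel_conjW x y T a b :
  mel (conjW x y T) a b = chi (y * (a - b)) * mel T (a - x) (b - x).
Proof.
rewrite /mel /conjW !comp_lfunE adj_shiftU adj_phaseV.
rewrite (adjointP _ hphi) (adjointP _ hphi) adj_shiftU adj_phaseV.
rewrite linearZ innerZl innerZr mulrA conj_chi // -chiD //.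
by congr (chi _ * _); ring.
Qed.

(** The phase depends only on [a - b], which the common shift of both indices leaves fixed, so no
    commutation phase survives. *)
Lemma conjW_comp x y x' y' T :
  conjW x y (conjW x' y' T) = conjW (x + x') (y + y') T.
Proof.
apply: mel_inj => a b; rewrite !mel_conjW mulrA -chiD // !opprD !addrA.
by congr (chi _ * _); ring.
Qed.

Lemma conjW_sum (I : finType) x y (F : I -> 'End(H)) :
  conjW x y (\sum_i F i) = \sum_i conjW x y (F i).
Proof.
apply: mel_inj => a b; rewrite mel_conjW !mel_sum mulr_sumr.
by apply: eq_bigr => i _; rewrite mel_conjW.
Qed.

Lemma conjWZ x y (c : R[i]) T : conjW x y (c *: T) = c *: conjW x y T.
Proof. by apply: mel_inj => a b; rewrite melZ !mel_conjW melZ mulrCA. Qed.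

Lemma conjW_positive x y T :
  positive_op dot T -> positive_op dot (conjW x y T).
Proof.
move=> T0 v; rewrite /conjW !comp_lfunE.
by rewrite (adjointP _ hphi) (adjointP _ hphi); apply: T0.
Qed.

Lemma conjW_obsA x y i : conjW x y (obsA dot phi i) = obsA dot phi (i + x).
Proof.
apply: mel_inj => a b; rewrite mel_conjW !mel_ketbra !(orthonormal_basisP hphi).
rewrite [i == _]eq_sym !subr_eq [b == _]eq_sym.
have [->|_] := eqVneq a (i + x); last by rewrite !mul0r mulr0.
have [<-|_] := eqVneq (i + x) b; last by rewrite !mulr0.
by rewrite subrr mulr0 chi0 mul1r.
Qed.

Lemma inner_phi_psi a k :
  inner dot (phi a) (psi phi k) = ((Num.sqrt d%:R)^-1)%:C%C * chi (a * k).
Proof.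
rewrite /psi innerZr inner_sumr (bigD1 a) //= big1 => [|h ha].
  by rewrite innerZr (orthonormal_basisP hphi) eqxx addr0 mulr1 chiM.
by rewrite innerZr (orthonormal_basisP hphi) eq_sym (negbTE ha) mulr0.
Qed.

(** The matrix elements of [obsB] at [k] are a constant times [chi ((a - b) * k)]: shifting [a] and
    [b] together changes nothing, and the factor [chi (y * (a - b))] turns [k] into [k + y]. *)
Lemma conjW_obsB x y k : conjW x y (obsB dot phi k) = obsB dot phi (k + y).
Proof.
apply: mel_inj => a b; rewrite mel_conjW !mel_ketbra.
rewrite !(innerC _ (phi _) (psi _ _)) !inner_phi_psi !rmorphM /= !conj_chi //.
set s := _%:C%C; set t := _^*.
have -> : chi (y * (a - b)) *
    (s * chi ((a - x) * k) * (t * chi (- ((b - x) * k)))) =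
  s * t * (chi (y * (a - b)) * chi ((a - x) * k) * chi (- ((b - x) * k))).
  by ring.
rewrite [in RHS]mulrACA -!chiD //; congr (_ * chi _).
by ring.
Qed.

(** Smearing is a convolution, hence commutes with translations. The separate [z] serves both
    observables: [x] for [obsA], [y] for [obsB]. *)
Lemma conjW_smeared x y z (Lambda : 'Z_d -> R) (E : 'Z_d -> 'End(H)) j :
  (forall i, conjW x y (E i) = E (i + z)) ->
  conjW x y (smeared Lambda E j) = smeared Lambda E (j + z).
Proof.
move=> covE; rewrite /smeared conjW_sum [RHS](reindex_inj (addIr z)) /=.
by apply: eq_bigr => i _; rewrite conjWZ covE opprD addrACA subrr addr0.
Qed.

(** * The Weyl average of a joint observable *)

Definition average (C : 'Z_d * 'Z_d -> 'End(H)) (p : 'Z_d * 'Z_d) : 'End(H) :=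
  (d%:R ^+ 2)^-1 *:
    \sum_(q : 'Z_d * 'Z_d) conjW q.1 q.2 (C (p.1 - q.1, p.2 - q.2)).

Lemma average_cst T :
  (d%:R ^+ 2)^-1 *: (\sum_(q : 'Z_d * 'Z_d) T) = T.
Proof.
have d0 : d%:R != 0 :> R[i] by rewrite pnatr_eq0 -lt0n (ltn_trans _ hd).
rewrite sumr_const card_prod card_ord Zp_cast // -[T *+ _]scaler_nat natrM -expr2.
by rewrite scalerA mulVf ?scale1r // expf_neq0.
Qed.

Lemma average_positive C :
  (forall p, positive_op dot (C p)) -> forall p, positive_op dot (average C p).
Proof.
move=> C0 p v; rewrite scale_lfunE innerZr sum_lfunE inner_sumr.
rewrite mulr_ge0 ?invr_ge0 ?exprn_ge0 ?ler0n //.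
by apply: sumr_ge0 => q _; apply: conjW_positive.
Qed.

(** Conjugation sends the term at [q] to the term at [(x + q.1, y + q.2)] of the average for the
    shifted outcome, so the sum is only permuted. *)
Lemma average_covariant C x y j k :
  conjW x y (average C (j, k)) = average C (j + x, k + y).
Proof.
rewrite /average conjWZ conjW_sum; congr (_ *: _).
have inj : injective (fun q : 'Z_d * 'Z_d => (x + q.1, y + q.2)).
  move=> [a b] [a' b'] [e1 e2].
  by congr pair; [apply: (addrI x) | apply: (addrI y)]; apply: val_inj.
rewrite [RHS](reindex_inj inj) /=; apply: eq_bigr => q _.
by rewrite conjW_comp !opprD !addrA !addrK.
Qed.

(** For each fixed [q], summing over [k] absorbs the shift by [q.2] and gives [E (j - q.1)], which
    conjugation carries back to [E j]; the mean is then over a constant. *)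
Lemma average_marginal1 C E :
  (forall j, \sum_k C (j, k) = E j) ->
  (forall x y j, conjW x y (E j) = E (j + x)) ->
  forall j, \sum_k average C (j, k) = E j.
Proof.
move=> CE covE j; rewrite -scaler_sumr exchange_big /= -[RHS]average_cst.
congr (_ *: _); apply: eq_bigr => q _.
rewrite -conjW_sum -[j in RHS](subrK q.1) -(covE _ q.2) -CE.
by rewrite [in RHS](reindex_inj (addIr (- q.2))).
Qed.

Lemma average_marginal2 C E :
  (forall k, \sum_j C (j, k) = E k) ->
  (forall x y k, conjW x y (E k) = E (k + y)) ->
  forall k, \sum_j average C (j, k) = E k.
Proof.
move=> CE covE k; rewrite -scaler_sumr exchange_big /= -[RHS]average_cst.
congr (_ *: _); apply: eq_bigr => q _.
rewrite -conjW_sum -[k in RHS](subrK q.2) -(covE q.1) -CE.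
by rewrite [in RHS](reindex_inj (addIr (- q.1))).
Qed.

Lemma average_joint_observable C E F :
  joint_observable dot E F C ->
  (forall x y j, conjW x y (E j) = E (j + x)) ->
  (forall x y k, conjW x y (F k) = F (k + y)) ->
  joint_observable dot E F (average C).
Proof.
move=> [[C0 C1] CE CF] covE covF.
have avE := average_marginal1 CE covE.
split=> //; last exact: average_marginal2.
split; first exact: average_positive.
have pairs (D : 'Z_d * 'Z_d -> 'End(H)) :
    \sum_p D p = \sum_j \sum_k D (j, k).
  by rewrite pair_bigA; apply: eq_bigr => -[].
(* Normalization is inherited: the average and [C] have the same first marginal, hence the same
   total. *)
rewrite -C1 !pairs; apply: eq_bigr => j _.
by rewrite avE CE.
Qed.

End Weyl.

Unset Implicit Arguments.

Theorem proposition1 (R : realType) (d : nat) (hd : (2 <= d)%N)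
  (H : vectType R[i]) (dimH : \dim {:H} = d) (dot : {dot H for Num.conj})
  (phi : 'Z_d -> H) (hphi : orthonormal_basis dot phi)
  (Lambda Gamma : 'Z_d -> R)
  (hLambda : prob_distr Lambda) (hGamma : prob_distr Gamma) :
  jointly_measurable dot (smeared Lambda (obsA dot phi))
    (smeared Gamma (obsB dot phi)) ->
  exists C : 'Z_d * 'Z_d -> 'End(H),
    joint_observable dot (smeared Lambda (obsA dot phi))
      (smeared Gamma (obsB dot phi)) C
    /\ covariant_phase_space dot phi C.
Proof.
move=> [C jointC]; exists (average dot phi C).
have joint : joint_observable dot (smeared Lambda (obsA dot phi))
    (smeared Gamma (obsB dot phi)) (average dot phi C).
  apply: average_joint_observable => // x y i; apply: conjW_smeared => // k.
    exact: conjW_obsA.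
  exact: conjW_obsB.
split=> //; split; first by case: joint.
by move=> j k x y; apply: average_covariant.
Qed.
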